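(* Let $T$ be a tree on $n$ vertices, with exactly $s>1$ split vertices, and let $r$ be a positive integer. Suppose that $s<r/2$ and $r\le\sqrt{n\ln c}-(\ln c)/2$, where $c=2-2s/r$. Then $T$ is $r$-EKR.
   Context: A split vertex of a graph is a vertex of degree at least 3. For a graph $G$, $\mathcal{I}^r(G)$ denotes the family of independent sets of $G$ of size exactly $r$, and $s_r(v)$ denotes the number of members of $\mathcal{I}^r(G)$ containing the vertex $v$. A family of sets is intersecting if every two of its members intersect. $G$ is called $r$-EKR if, letting $\mathcal{F}\subseteq \mathcal{I}^r(G)$ be an intersecting subfamily of maximum size, some vertex $v$ satisfies $s_r(v)=|\mathcal{F}|$. *)

(* Defs.v *)
From mathcomp Require Import all_boot.
Set Implicit Arguments.
Unset Strict Implicit.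
Unset Printing Implicit Defensive.

(* A graph on the finite vertex type V is given by its adjacency relation. *)
Definition simple_graph (V : finType) (e : rel V) : Prop :=
  symmetric e /\ irreflexive e.

Definition connected_graph (V : finType) (e : rel V) : Prop :=
  0 < #|V| /\ forall x y : V, connect e x y.

(* Closed walks of length at most 2 are not graph cycles, although an edge *)
(* xy does make [:: x; y] a ucycle: hence the bound on the size.           *)
Definition acyclic_graph (V : finType) (e : rel V) : Prop :=
  forall p : seq V, 2 < size p -> ~ ucycle e p.

Definition tree (V : finType) (e : rel V) : Prop :=
  [/\ simple_graph e, connected_graph e & acyclic_graph e].

Definition degree (V : finType) (e : rel V) (x : V) : nat :=
  #|[set y | e x y]|.

Definition split_vertices (V : finType) (e : rel V) : {set V} :=
  [set x | 3 <= degree e x].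

Definition independent (V : finType) (e : rel V) (A : {set V}) : bool :=
  [forall x in A, forall y in A, ~~ e x y].

Definition indep_sets (V : finType) (e : rel V) (r : nat) : {set {set V}} :=
  [set A : {set V} | independent e A & #|A| == r].

(* s_r(v) *)
Definition star_size (V : finType) (e : rel V) (r : nat) (v : V) : nat :=
  #|[set A in indep_sets e r | v \in A]|.

Definition intersecting (V : finType) (F : {set {set V}}) : Prop :=
  forall A B : {set V}, A \in F -> B \in F -> A :&: B != set0.

Definition max_intersecting (V : finType) (e : rel V) (r : nat)
    (F : {set {set V}}) : Prop :=
  [/\ F \subset indep_sets e r, intersecting F &
      forall F' : {set {set V}}, F' \subset indep_sets e r ->
        intersecting F' -> #|F'| <= #|F|].

Definition EKR (V : finType) (e : rel V) (r : nat) : Prop :=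
  forall F : {set {set V}}, max_intersecting e r F ->
    exists v : V, star_size e r v = #|F|.

(* Main.v *)
(* A starless intersecting family F of r-sets of an n-set satisfies the
   Hilton-Milner bound |F| <= C(n-1,r-1) - C(n-r-1,r-1) + 1. On the other hand
   a forest on m vertices has at least C(m-k+1,k) independent k-sets (delete a
   vertex of degree at most 1), so the star of a leaf of T has at least
   C(n-r,r-1) > C(n-r-1,r-1) members. The hypothesis on r says that
   r^2 + r ln c < n ln c, and this yields C(n-1,r-1) <= c C(n-r-1,r-1), by
   comparing the falling factorials factor by factor and 1 + x <= exp x. As
   c < 2, the leaf star is at least as large as any starless family.

   The Hilton-Milner bound is obtained by shifting. A family that cannot be
   shifted without becoming a star is covered by two points, and is then
   controlled by a bound on pairs of cross-intersecting families; a fully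
   shifted family is treated by induction on the ground set, splitting it by
   the largest element. *)
Require Import Defs.
From mathcomp Require Import all_boot all_order all_algebra.
From mathcomp Require Import reals sequences exp.
From mathcomp Require Import zify lra.
Import Order.TTheory GRing.Theory Num.Theory.
Set Implicit Arguments.
Unset Strict Implicit.
Unset Printing Implicit Defensive.

(** * Uniform families: sets meeting a fixed set, and complementation *)

Section SetFamilies.
Variable T : finType.
Implicit Types (A B D : {set T}) (F P Q : {set {set T}}) (x y z v : T).

Definition draws D k : {set {set T}} := [set A : {set T} | (A \subset D) && (#|A| == k)].

Lemma drawsP D k A : reflect (A \subset D /\ #|A| = k) (A \in draws D k).
Proof. by rewrite inE; apply: (iffP andP) => -[? /eqP]. Qed.

Lemma card_draws D k : #|draws D k| = 'C(#|D|, k).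
Proof. exact: cards_draws. Qed.

Definition cross_intersecting P Q :=
  forall A B, A \in P -> B \in Q -> A :&: B != set0.

Definition starless F := forall v, exists2 A, A \in F & v \notin A.

Lemma setI_neq0P A B : reflect (exists2 x, x \in A & x \in B) (A :&: B != set0).
Proof.
apply: (iffP (set0Pn _)) => [[x /setIP[]]|[x xA xB]]; first by exists x.
by exists x; apply/setIP.
Qed.

Lemma cross_intersectingC P Q : cross_intersecting P Q -> cross_intersecting Q P.
Proof. by move=> PQ A B AQ BP; rewrite setIC; apply: PQ. Qed.

(** The [k]-subsets of [D :\: B] miss [B], so none of them belongs to [F]. *)
Lemma card_meeting D B k F : B \subset D -> F \subset draws D k ->
  (forall A, A \in F -> A :&: B != set0) ->
  #|F| + 'C(#|D| - #|B|, k) <= 'C(#|D|, k).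
Proof.
move=> BD FD meet.
have <- : #|D :\: B| = #|D| - #|B| by rewrite cardsD (setIidPr BD).
rewrite -!card_draws.
have dis : F :&: draws (D :\: B) k = set0.
  apply/setP=> A; rewrite !inE; apply/negbTE/negP => /and3P[/meet /setI_neq0P[x xA xB]].
  by move=> /subsetP /(_ x xA); rewrite inE xB.
rewrite -cardsUI dis cards0 addn0 subset_leq_card // subUset FD /=.
apply/subsetP=> A /drawsP[AD Ak]; apply/drawsP; split=> //.
exact: subset_trans AD (subsetDl _ _).
Qed.

(** Complementation in [D] embeds [Q] into the [k]-subsets, and the image is disjoint from [P]
    because a set never meets its complement. *)
Lemma cross_intersecting_half D k P Q : #|D| = k.*2 ->
  P \subset draws D k -> Q \subset draws D k -> cross_intersecting P Q ->
  #|P| + #|Q| <= 'C(#|D|, k).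
Proof.
move=> Dk PD QD PQ; rewrite -card_draws.
have inj : {in Q &, injective (fun A => D :\: A)}.
  move=> A B /(subsetP QD) /drawsP[AD _] /(subsetP QD) /drawsP[BD _] /= E.
  have DD (C : {set T}) : C \subset D -> D :\: (D :\: C) = C.
    by move=> CD; rewrite setDDr setDv set0U; apply/setIidPr.
  by rewrite -(DD A) // E DD.
rewrite -(card_in_imset inj) -cardsUI.
have -> : P :&: [set D :\: A | A in Q] = set0.
  apply/setP=> A; rewrite in_set0; apply/negbTE/negP => /setIP[AP /imsetP[B BQ E]].
  have /setI_neq0P[x] := PQ _ _ AP BQ.
  by rewrite E inE => /andP[/negbTE ->].
rewrite cards0 addn0 subset_leq_card // subUset PD /=.
apply/subsetP=> _ /imsetP[A /(subsetP QD)/drawsP[AD Ak] ->].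
apply/drawsP; rewrite subsetDl; split=> //.
by rewrite cardsD (setIidPr AD) Ak Dk; lia.
Qed.

(** * Deletion and link of a family at a point *)

Definition deletion z F := [set A in F | z \notin A].
Definition link z F := [set A :\ z | A in [set A in F | z \in A]].

Lemma linkP z F A : reflect (z \notin A /\ z |: A \in F) (A \in link z F).
Proof.
apply: (iffP imsetP) => [[B]|[zA AF]].
  by rewrite inE => /andP[BF zB] ->; rewrite setD11 setD1K.
by exists (z |: A); rewrite ?inE ?AF ?eqxx // setU1K.
Qed.

Lemma deletionP z F A : reflect (A \in F /\ z \notin A) (A \in deletion z F).
Proof. by rewrite inE; apply: andP. Qed.

Lemma card_link_deletion z F : #|F| = #|link z F| + #|deletion z F|.
Proof.
rewrite card_in_imset => [|A B]; last first.
  by rewrite !inE => /andP[_ zA] /andP[_ zB] E; rewrite -(setD1K zA) E setD1K.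
rewrite -cardsUI [X in _ + X](_ : _ = 0) ?addn0; last first.
  by apply/eqP; rewrite cards_eq0; apply/eqP/setP=> A; rewrite !inE; case: (z \in A); rewrite ?andbF.
by congr #|pred_of_set _|; apply/setP=> A; rewrite !inE; case: (z \in A); rewrite ?andbT ?andbF ?orbF.
Qed.

Lemma link_draws z D k F : F \subset draws D k.+1 -> link z F \subset draws (D :\ z) k.
Proof.
move=> /subsetP FD; apply/subsetP=> A /linkP[zA /FD/drawsP[AD Ak]].
apply/drawsP; split; last by move: Ak; rewrite cardsU1 zA add1n => -[].
by rewrite subsetD1 zA andbT; apply: subset_trans AD; apply: subsetUr.
Qed.

Lemma deletion_draws z D k F : F \subset draws D k -> deletion z F \subset draws (D :\ z) k.
Proof.
move=> /subsetP FD; apply/subsetP=> A /deletionP[/FD/drawsP[AD Ak] zA].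
by apply/drawsP; rewrite subsetD1 AD zA.
Qed.

(** * Shifted families and the exchange of the largest element *)

Definition move_elt x y A := x |: (A :\ y).

Definition shifted D F := forall A x y, A \in F -> x \in D -> y \in D ->
  enum_rank x < enum_rank y -> y \in A -> x \notin A -> move_elt x y A \in F.

Lemma shifted_deletion z D F : shifted D F -> shifted (D :\ z) (deletion z F).
Proof.
move=> sF A x y /deletionP[AF zA] /setD1P[xz xD] /setD1P[yz yD] xy yA xA.
by apply/deletionP; split; [exact: sF | rewrite !inE negb_or negb_and zA orbT andbT eq_sym].
Qed.

Lemma shifted_link z D F : shifted D F -> shifted (D :\ z) (link z F).
Proof.
move=> sF A x y /linkP[zA AF] /setD1P[xz xD] /setD1P[yz yD] xy yA xA.
apply/linkP; split; first by rewrite !inE negb_or negb_and zA orbT andbT eq_sym.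
have -> : z |: move_elt x y A = move_elt x y (z |: A).
  apply/setP=> w; rewrite !inE; case: (eqVneq w z) => [->|_] //=.
  by rewrite [z == y]eq_sym yz orbT.
by apply: sF => //; rewrite !inE ?yA ?orbT // negb_or xz.
Qed.

Definition top_elt D z := z \in D /\ forall x, x \in D -> x != z -> enum_rank x < enum_rank z.

Lemma top_elt_exists D : 0 < #|D| -> exists z, top_elt D z.
Proof.
case/card_gt0P=> x0 x0D; case: (@arg_maxnP _ x0 (mem D) (fun x => enum_rank x) x0D) => z zD zM.
exists z; split=> // x xD xz; rewrite ltn_neqAle; apply/andP; split; last exact: zM.
by apply: contra xz => /eqP /val_inj /enum_rank_inj ->.
Qed.

Lemma fresh_elt D B : #|B| < #|D| -> exists2 x, x \in D & x \notin B.
Proof.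
move=> BD; have : ~~ (D \subset B) by apply/negP => /subset_leq_card; rewrite leqNgt BD.
by case/subsetPn=> x; exists x.
Qed.

(** Every other element of [D] precedes the top one, so [z] may be exchanged for any element missing
    from [A]; the cardinality bound leaves one that [B] misses too. *)
Lemma shifted_replace_top D F z A B : top_elt D z -> shifted D F ->
  A \in F -> z \in A -> z \in B -> #|A :|: B| < #|D| ->
  exists x, [/\ x \notin A, x \notin B & x |: (A :\ z) \in F].
Proof.
move=> [zD zM] sF AF zA zB /fresh_elt[x xD]; rewrite inE negb_or => /andP[xA xB].
by exists x; split=> //; apply: sF => //; apply: zM => //; apply: contraNneq xA => ->.
Qed.

(** Two [k.+1]-sets sharing [z] leave a point of [D] uncovered. Exchanging [z] for it in the first
    set leaves a member of [P], which must meet the second set in an old point other than [z]. *)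
Lemma cross_intersecting_link D k P Q z : top_elt D z -> k.+1.*2 <= #|D| ->
  P \subset draws D k.+1 -> Q \subset draws D k.+1 -> shifted D P ->
  cross_intersecting P Q -> cross_intersecting (link z P) (link z Q).
Proof.
move=> tz kD PD QD sP PQ A B /linkP[zA AP] /linkP[zB BQ].
have [_ Ak] := drawsP _ _ _ (subsetP PD _ AP).
have [_ Bk] := drawsP _ _ _ (subsetP QD _ BQ).
have [|||x [xA xB xP]] := @shifted_replace_top _ _ _ _ (z |: B) tz sP AP; rewrite ?setU11 //.
  have := cardsUI (z |: A) (z |: B); rewrite Ak Bk.
  have : 0 < #|(z |: A) :&: (z |: B)| by apply/card_gt0P; exists z; rewrite !inE eqxx.
  lia.
have /setI_neq0P[w] := PQ _ _ xP BQ; rewrite setU1K // => /setU1P[->|wA wB].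
  by rewrite (negbTE xB).
apply/setI_neq0P; exists w => //; case/setU1P: wB => // wz.
by move: zA; rewrite -wz wA.
Qed.

Lemma shifted_deletion_neq0 D k F z : top_elt D z -> k < #|D| ->
  F \subset draws D k -> shifted D F -> F != set0 -> deletion z F != set0.
Proof.
move=> tz kD FD sF /set0Pn[A AF]; apply/set0Pn.
have [_ Ak] := drawsP _ _ _ (subsetP FD _ AF).
case: (boolP (z \in A)) => zA; last by exists A; apply/deletionP.
have [|x [xA _ xF]] := shifted_replace_top tz sF AF zA zA; first by rewrite setUid Ak.
by exists (x |: (A :\ z)); apply/deletionP; split=> //; rewrite !inE eqxx orbF; apply: contraNneq xA => <-.
Qed.

(** * Cross-intersecting and Hilton-Milner bounds for shifted families *)

Lemma bin_succ_lt n k : k <= n -> 'C(n, k.+1) < 'C(n.+1, k.+1).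
Proof. by move=> kn; rewrite binS -[X in X < _]addn0 ltn_add2l bin_gt0. Qed.

(** The bound is attained by a single set together with all sets meeting it. Induction removes the
    top element: the deletions keep the spare 1, the links satisfy the bound without it, and
    Pascal's rule adds the two. *)
Lemma cross_intersecting_shifted D k P Q : k.*2 <= #|D| ->
  P \subset draws D k -> Q \subset draws D k -> shifted D P -> shifted D Q ->
  P != set0 -> Q != set0 -> cross_intersecting P Q ->
  #|P| + #|Q| + 'C(#|D| - k, k) <= 'C(#|D|, k) + 1.
Proof.
move mD : #|D| => m; elim: m => [|m IH] in D k P Q mD *.
  case: k => // _ /subsetP PD /subsetP QD _ _ /set0Pn[A AP] /set0Pn[B BQ] /(_ A B AP BQ).
  by case/drawsP: (PD _ AP) => _ /eqP; rewrite cards_eq0 => /eqP ->; rewrite set0I eqxx.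
(* If [#|D| = k.*2], the subtracted binomial is 1 and cancels the spare 1, so complementation
   suffices. *)
rewrite leq_eqVlt => /predU1P[E PD QD _ _ _ _ PQ|].
  have := cross_intersecting_half _ PD QD PQ; rewrite mD E => /(_ erefl).
  by rewrite (_ : m.+1 - k = k) ?binn ?leq_add2r //; lia.
move=> km PD QD sP sQ P0 Q0 PQ.
case: k => [|k] in km PD QD *.
  case/set0Pn: P0 => A AP; case/set0Pn: Q0 => B BQ; have := PQ _ _ AP BQ.
  case/drawsP: (subsetP PD _ AP) => _ /eqP; rewrite cards_eq0 => /eqP ->.
  by rewrite set0I eqxx.
have [|z tz] := @top_elt_exists D; first by rewrite mD.
have mDz : #|D :\ z| = m by have := cardsD1 z D; rewrite mD tz.1 add1n => -[].
have P0' : deletion z P != set0 by apply: (shifted_deletion_neq0 tz _ PD) => //; lia.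
have Q0' : deletion z Q != set0 by apply: (shifted_deletion_neq0 tz _ QD) => //; lia.
have del_le : #|deletion z P| + #|deletion z Q| + 'C(m - k.+1, k.+1) <= 'C(m, k.+1) + 1.
  have km' : k.+1.*2 <= m by lia.
  apply: (IH _ _ _ _ mDz km' (deletion_draws z PD) (deletion_draws z QD) _ _ P0' Q0').
  - exact: shifted_deletion.
  - exact: shifted_deletion.
  by move=> A B /deletionP[AP _] /deletionP[BQ _]; apply: PQ.
have link_le : #|link z P| + #|link z Q| + 'C(m - k.+1, k) <= 'C(m, k).
  (* With one link empty, every set of the other link must meet a fixed set [B] of the first
     deletion, and [card_meeting] applies. *)
  have one P' Q' : P' \subset draws D k.+1 -> Q' \subset draws D k.+1 ->
     cross_intersecting P' Q' -> deletion z P' != set0 -> link z P' = set0 ->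
     #|link z P'| + #|link z Q'| + 'C(m - k.+1, k) <= 'C(m, k).
    move=> PD' QD' PQ' /set0Pn[B BP] ->; rewrite cards0 add0n.
    have /drawsP[BD <-] := subsetP (deletion_draws z PD') _ BP.
    rewrite -mDz; apply: card_meeting => //; first exact: link_draws.
    move=> A /linkP[zA AQ]; have /deletionP[BP' zB] := BP.
    have /setI_neq0P[w wB /setU1P[wz|wA]] := PQ' _ _ BP' AQ; first by rewrite -wz wB in zB.
    by apply/setI_neq0P; exists w.
  have [E|lP] := eqVneq (link z P) set0; first exact: one.
  have [E|lQ] := eqVneq (link z Q) set0.
    by rewrite [#|link z P| + _]addnC; apply: one => //; apply: cross_intersectingC.
  have PQl : cross_intersecting (link z P) (link z Q).
    by apply: cross_intersecting_link PQ => //; eauto; rewrite mD ltnW.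
  have : #|link z P| + #|link z Q| + 'C(m - k, k) <= 'C(m, k) + 1.
    have km' : k.*2 <= m by lia.
    apply: (IH _ _ _ _ mDz km' (link_draws z PD) (link_draws z QD) _ _ lP lQ PQl).
    - exact: shifted_link.
    - exact: shifted_link.
  (* For [k = 0] a link contains only the empty set, which meets nothing. Otherwise the strict
     inequality between the binomials over [m - k.+1] and [m - k] absorbs the spare 1. *)
  case: k {IH del_le one} => [|k] in km PD QD *.
    have := link_draws z PD; case/set0Pn: lP => A AP /subsetP /(_ _ AP) /drawsP[_ /eqP].
    rewrite cards_eq0 => /eqP A0; case/set0Pn: lQ => B BQ; have := PQl _ _ AP BQ.
    by rewrite A0 set0I eqxx.
  have -> : m - k.+1 = (m - k.+2).+1 by lia.
  have : 'C(m - k.+2, k.+1) < 'C((m - k.+2).+1, k.+1) by apply: bin_succ_lt; lia.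
  by lia.
rewrite (card_link_deletion z P) (card_link_deletion z Q) binS.
have -> : m.+1 - k.+1 = (m - k.+1).+1 by lia.
rewrite binS; lia.
Qed.

Lemma starless_card1 D F : F \subset draws D 1 -> intersecting F -> F != set0 -> ~ starless F.
Proof.
move=> /subsetP FD FI /set0Pn[A AF] sl.
have /drawsP[_ /eqP/cards1P[a Aa]] := FD _ AF.
have [B BF aB] := sl a; have := FI _ _ AF BF.
by rewrite Aa setI_eq0 disjoints1 aB.
Qed.

Lemma hilton_milner_shifted D r F : r.+1.*2 <= #|D| ->
  F \subset draws D r.+1 -> shifted D F -> F != set0 -> intersecting F -> starless F ->
  #|F| + 'C(#|D| - r.+2, r) <= 'C(#|D|.-1, r) + 1.
Proof.
move mD : #|D| => m; elim: m => [|m IH] in D r F mD * => //.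
(* At [#|D| = r.+1.*2], applying complementation to the pair [F], [F] gives twice [#|F|] at most the
   central binomial, which is twice ['C(m, r)]. *)
rewrite leq_eqVlt => /predU1P[E FD _ _ FI _|].
  have := @cross_intersecting_half D r.+1 F F _ FD FD FI; rewrite mD => /(_ (esym E)).
  rewrite /= (_ : m.+1 - r.+2 = r); last by lia.
  rewrite binn leq_add2r binS.
  have -> : 'C(m, r.+1) = 'C(m, r) by rewrite -(@bin_sub m r); [congr 'C(_, _); lia | lia].
  by lia.
move=> rm FD sF F0 FI sl.
case: r => [|r] in rm FD *; first by case: (starless_card1 FD FI F0 sl).
have [|z tz] := @top_elt_exists D; first by rewrite mD.
have mDz : #|D :\ z| = m by have := cardsD1 z D; rewrite mD tz.1 add1n => -[].
have F0' : deletion z F != set0 by apply: (shifted_deletion_neq0 tz _ FD) => //; lia.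
(* A member avoiding [v] but containing [z] can have [z] exchanged for an element other than [v]. *)
have sl' : starless (deletion z F).
  move=> v; have [A AF vA] := sl v.
  have [zA|zA] := boolP (z \in A); last by exists A => //; apply/deletionP.
  have /drawsP[_ Ar] := subsetP FD _ AF.
  have [||x [xA]] := @shifted_replace_top _ _ _ _ [set v; z] tz sF AF zA.
  - by rewrite !inE eqxx orbT.
  - have -> : A :|: [set v; z] = v |: A.
      apply/setP=> w; rewrite !inE; case: (eqVneq w z) => [->|_]; rewrite ?zA ?orbT ?orbF //.
      by rewrite orbC.
    by rewrite cardsU1 vA Ar; lia.
  rewrite !inE negb_or => /andP[xv xz] xF.
  exists (x |: (A :\ z)); last by rewrite !inE negb_or eq_sym xv (negbTE vA) andbF.
  by apply/deletionP; split=> //; rewrite !inE eqxx orbF eq_sym.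
have del_le : #|deletion z F| + 'C(m - r.+3, r.+1) <= 'C(m.-1, r.+1) + 1.
  apply: (IH _ r.+1 _ mDz _ (deletion_draws z FD) (shifted_deletion (z := z) sF) F0' _ sl').
    by lia.
  by move=> A B /deletionP[? _] /deletionP[? _]; apply: FI.
have link_le : #|link z F| + 'C(m - r.+3, r) <= 'C(m.-1, r).
  have lD := link_draws z FD.
  (* A starless link falls under the induction hypothesis, whose spare 1 is again absorbed by a
     strict inequality of binomials. *)
  have [/forallP slz|/forallPn[v /existsPn vF]] :=
     boolP [forall v, exists A, (A \in link z F) && (v \notin A)].
    have slz' : starless (link z F) by move=> v; have /existsP[A /andP[]] := slz v; exists A.
    have lF0 : link z F != set0 by case: (slz' z) => A AF _; apply/set0Pn; exists A.
    have lI : intersecting (link z F).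
      by apply: (cross_intersecting_link tz _ FD FD sF FI); rewrite mD ltnW.
    have rm' : r.+1.*2 <= m by lia.
    have := IH _ r _ mDz rm' lD (shifted_link (z := z) sF) lF0 lI slz'.
    case: r {IH del_le} => [|r] in rm rm' FD lD *; first by case: (starless_card1 lD lI lF0 slz').
    rewrite (_ : m - r.+3 = (m - r.+4).+1); last by lia.
    have : 'C(m - r.+4, r.+1) < 'C((m - r.+4).+1, r.+1) by apply: bin_succ_lt; lia.
    by move=> lt le; rewrite -ltnS -[X in _ < X]addn1 (leq_trans _ le) // ltn_add2l.
  (* Now [v] lies in every set of the link. Some [B] in [F] avoids both [v] and [z], so the sets of
     the link, stripped of [v], still meet [B]. *)
  have [B BF vB] := sl' v.
  have /deletionP[BF' zB] := BF.
  have /drawsP[BD Br] := subsetP (deletion_draws z FD) _ BF.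
  have star A : A \in link z F -> v \in A by move=> AF; have := vF A; rewrite AF /= negbK.
  have [->|/set0Pn[A0 A0F]] := eqVneq (link z F) set0.
    by rewrite cards0 leq_bin2l //; lia.
  have vD : v \in D :\ z.
    by have /drawsP[/subsetP/(_ v (star _ A0F))] := subsetP lD _ A0F.
  have mDv : #|D :\ z :\ v| = m.-1 by rewrite -mDz (cardsD1 v (D :\ z)) vD.
  have -> : m - r.+3 = #|D :\ z :\ v| - #|B| by rewrite mDv Br -subn1 -subnDA.
  rewrite -mDv (card_link_deletion v (link z F)).
  have -> : deletion v (link z F) = set0.
    by apply/setP=> A; rewrite !inE; apply/negbTE/negP => /andP[/star ->].
  rewrite cards0 addn0; apply: card_meeting; first by rewrite subsetD1 BD.
    exact: link_draws.
  move=> A /linkP[vA /linkP[zA AF]].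
  have /setI_neq0P[w /setU1P[->|/setU1P[->|wA]] wB] := FI _ _ AF BF'.
  - by rewrite wB in zB.
  - by rewrite wB in vB.
  - by apply/setI_neq0P; exists w.
rewrite (card_link_deletion z F) /=.
rewrite (_ : m.+1 - r.+3 = (m - r.+3).+1); last by lia.
rewrite -[X in 'C(X, _) + 1](_ : m.-1.+1 = m); last by lia.
have := leq_add link_le del_le; rewrite !binS.
move: 'C(m - r.+3, r.+1) 'C(m - r.+3, r) 'C(m.-1, r.+1) 'C(m.-1, r) => a b c d.
by move: #|link z F| #|deletion z F| => l d'; lia.
Qed.

(** * The shifting operation and what it preserves *)

Definition moves x y F A := [&& y \in A, x \notin A & move_elt x y A \notin F].
(** A set stays in place when its moved copy already lies in [F]; this is what makes the map
    injective on [F]. *)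
Definition shift_set x y F A := if moves x y F A then move_elt x y A else A.
Definition shift x y F := [set shift_set x y F A | A in F].

Lemma move_eltK x y A : y \in A -> x \notin A -> move_elt y x (move_elt x y A) = A.
Proof.
move=> yA xA; rewrite /move_elt setU1K ?setD1K //.
by rewrite inE negb_and xA orbT.
Qed.

Lemma shift_set_inj x y F : {in F &, injective (shift_set x y F)}.
Proof.
move=> A B AF BF; rewrite /shift_set.
case: ifP => [/and3P[yA xA mA]|_]; case: ifP => [/and3P[yB xB mB]|_] E //.
- by rewrite -(move_eltK yA xA) E move_eltK.
- by rewrite E BF in mA.
- by rewrite -E AF in mB.
Qed.

Lemma card_shift x y F : #|shift x y F| = #|F|.
Proof. by rewrite card_in_imset //; apply: shift_set_inj. Qed.

Lemma card_move_elt x y A : y \in A -> x \notin A -> #|move_elt x y A| = #|A|.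
Proof.
by move=> yA xA; rewrite cardsU1 inE negb_and xA orbT add1n -[in RHS](setD1K yA) cardsU1 setD11.
Qed.

Lemma shift_draws x y D k F : x \in D -> F \subset draws D k -> shift x y F \subset draws D k.
Proof.
move=> xD /subsetP FD; apply/subsetP=> _ /imsetP[A /FD/drawsP[AD Ak] ->].
rewrite /shift_set; case: ifP => [/and3P[yA xA _]|_]; apply/drawsP; last by [].
rewrite card_move_elt //; split=> //.
by rewrite subUset sub1set xD; apply: subset_trans AD; apply: subsetDl.
Qed.

Lemma shift_neq0 x y F : F != set0 -> shift x y F != set0.
Proof. by rewrite -!card_gt0 card_shift. Qed.

(** The mixed case, where [A] moves and [B] stays. If [B] contains [y] but not [x], it stays because
    its moved copy is in [Q]; [A] meets that copy in a point other than [x] and [y], which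
    survives. *)
Lemma move_elt_meet x y P Q A B : cross_intersecting P Q -> A \in P -> B \in Q ->
  moves x y P A -> ~~ moves x y Q B -> move_elt x y A :&: B != set0.
Proof.
move=> PQ AP BQ /and3P[yA xA mA] nB; apply/setI_neq0P.
have [xB|xB] := boolP (x \in B); first by exists x => //; rewrite !inE eqxx.
have [yB|yB] := boolP (y \in B).
  have : move_elt x y B \in Q by move: nB; rewrite /moves yB xB /= negbK.
  move=> /(PQ _ _ AP) /setI_neq0P[w wA /setU1P[wx|/setD1P[wy wB]]].
    by rewrite -wx wA in xA.
  by exists w; rewrite // !inE wy wA orbT.
have /setI_neq0P[w wA wB] := PQ _ _ AP BQ.
by exists w; rewrite // !inE wA andbT (contraNneq _ yB) ?orbT // => <-.
Qed.

Lemma cross_intersecting_shift x y P Q : cross_intersecting P Q ->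
  cross_intersecting (shift x y P) (shift x y Q).
Proof.
move=> PQ _ _ /imsetP[A AP ->] /imsetP[B BQ ->]; rewrite /shift_set.
case: ifP => [mA|/negbT mA]; case: ifP => [mB|/negbT mB].
- by apply/setI_neq0P; exists x; rewrite !inE eqxx.
- exact: (move_elt_meet PQ AP BQ mA mB).
- by rewrite setIC; apply: (move_elt_meet (cross_intersectingC PQ) BQ AP mB mA).
- exact: PQ.
Qed.

(** Termination measure: a shift towards a smaller rank strictly lowers it as soon as one set
    moves. *)
Definition weight F := \sum_(A in F) \sum_(a in A) enum_rank a.

Lemma weight_move_elt x y A : enum_rank x < enum_rank y -> y \in A -> x \notin A ->
  \sum_(a in move_elt x y A) enum_rank a < \sum_(a in A) enum_rank a.
Proof.
move=> xy yA xA; rewrite big_setU1 /=; last by rewrite inE negb_and xA orbT.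
by rewrite [X in _ < X](big_setD1 y) //= ltn_add2r.
Qed.

Lemma leq_weight_shift x y F : enum_rank x < enum_rank y -> weight (shift x y F) <= weight F.
Proof.
move=> xy; rewrite /weight big_imset /=; last exact: shift_set_inj.
apply: leq_sum => A AF; rewrite /shift_set; case: ifP => // /and3P[yA xA _].
exact/ltnW/weight_move_elt.
Qed.

Lemma ltn_weight_shift x y F A : enum_rank x < enum_rank y -> A \in F -> moves x y F A ->
  weight (shift x y F) < weight F.
Proof.
move=> xy AF mA; rewrite /weight big_imset /=; last exact: shift_set_inj.
rewrite (big_setD1 A) //= [X in _ < X](big_setD1 A) //= -addSn leq_add //.
  by rewrite /shift_set mA; case/and3P: mA => yA xA _; apply: weight_move_elt.
apply: leq_sum => B /setD1P[_ BF]; rewrite /shift_set; case: ifP => // /and3P[yB xB _].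
exact/ltnW/weight_move_elt.
Qed.

(** * Reduction to shifted families and the Hilton-Milner bound *)

Variant shifted_spec D F : Prop :=
| Shifted of shifted D F
| NotShifted A x y of A \in F & x \in D & y \in D & enum_rank x < enum_rank y & moves x y F A.

Lemma shiftedP D F : shifted_spec D F.
Proof.
pose t := [exists A in F, exists x in D, exists y in D,
  (enum_rank x < enum_rank y) && moves x y F A].
have [/exists_inP[A AF /exists_inP[x xD /exists_inP[y yD /andP[xy m]]]]|nt] := boolP t.
  exact: NotShifted AF xD yD xy m.
apply: Shifted => A x y AF xD yD xy yA xA; apply: contraR nt => nF.
apply/exists_inP; exists A => //; apply/exists_inP; exists x => //.
by apply/exists_inP; exists y; rewrite // xy /moves yA xA.
Qed.

(** Shifting both families at once keeps their sizes and the cross-intersection; the total weight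
    drops until both are shifted. *)
Lemma cross_intersecting_card D k P Q : k.*2 <= #|D| ->
  P \subset draws D k -> Q \subset draws D k ->
  P != set0 -> Q != set0 -> cross_intersecting P Q ->
  #|P| + #|Q| + 'C(#|D| - k, k) <= 'C(#|D|, k) + 1.
Proof.
move=> kD; have [w] := ubnP (weight P + weight Q).
elim: w => // w IH in P Q * => wPQ PD QD P0 Q0 PQ.
have step x y : x \in D -> enum_rank x < enum_rank y ->
    weight (shift x y P) + weight (shift x y Q) < weight P + weight Q ->
    #|P| + #|Q| + 'C(#|D| - k, k) <= 'C(#|D|, k) + 1.
  move=> xD xy lt; rewrite -(card_shift x y P) -(card_shift x y Q).
  apply: IH; rewrite ?shift_draws ?shift_neq0 //; first by lia.
  exact: cross_intersecting_shift.
have [sP|A x y AP xD yD xy m] := shiftedP D P; last first.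
  apply: (step x y) => //; have := ltn_weight_shift xy AP m; have := leq_weight_shift Q xy; lia.
have [sQ|A x y AQ xD yD xy m] := shiftedP D Q; last first.
  apply: (step x y) => //; have := ltn_weight_shift xy AQ m; have := leq_weight_shift P xy; lia.
exact: cross_intersecting_shifted.
Qed.

(* If a shift turns a starless family into a star, the family is covered by two points. *)
Lemma hilton_milner_cover2 D r F x y : r.+1.*2 <= #|D| -> F \subset draws D r.+1 ->
  intersecting F -> starless F -> x \in D -> y \in D -> x != y ->
  (forall A, A \in F -> (x \in A) || (y \in A)) ->
  #|F| + 'C(#|D| - r.+2, r) <= 'C(#|D|.-1, r) + 1.
Proof.
move=> rD FD FI sl xD yD xy cov.
have yDx : y \in D :\ x by rewrite !inE eq_sym xy.
have Dx : #|D :\ x| = #|D|.-1 by have := cardsD1 x D; rewrite xD; lia.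
have Dxy : #|D :\ x :\ y| = #|D|.-2 by have := cardsD1 y (D :\ x); rewrite yDx; lia.
have Dyx : D :\ y :\ x = D :\ x :\ y by rewrite setDDl setUC -setDDl.
(* [P] comes from the members containing [x] only, [Q] from those containing [y] only; starlessness
   makes both nonempty. *)
pose P := deletion y (link x F); pose Q := link y (deletion x F).
have PD : P \subset draws (D :\ x :\ y) r by rewrite deletion_draws ?link_draws.
have QD : Q \subset draws (D :\ x :\ y) r by rewrite link_draws // deletion_draws.
have P0 : P != set0.
  have [A AF yA] := sl y; have := cov _ AF; rewrite (negbTE yA) orbF => xA.
  apply/set0Pn; exists (A :\ x); apply/deletionP; split.
    by apply/linkP; rewrite setD11 setD1K.
  by rewrite inE (negbTE yA) andbF.
have Q0 : Q != set0.
  have [A AF xA] := sl x; have := cov _ AF; rewrite (negbTE xA) /= => yA.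
  apply/set0Pn; exists (A :\ y); apply/linkP; rewrite setD11 setD1K //; split=> //.
  by apply/deletionP.
have PQ : cross_intersecting P Q.
  move=> A B /deletionP[/linkP[xA AF] yA] /linkP[yB /deletionP[BF xB]].
  have /setI_neq0P[w /setU1P[->|wA]] := FI _ _ AF BF; first by rewrite (negbTE xB).
  case/setU1P => [wy|wB]; first by rewrite -wy wA in yA.
  by apply/setI_neq0P; exists w.
have le1 : #|P| + #|Q| + 'C(#|D|.-2 - r, r) <= 'C(#|D|.-2, r) + 1.
  by rewrite -Dxy; apply: cross_intersecting_card => //; rewrite Dxy; lia.
have zero : deletion y (deletion x F) = set0.
  apply/setP=> A; rewrite !inE; apply/negbTE/negP => /andP[/andP[/cov]].
  by case/orP => ->.
rewrite (card_link_deletion x F) (card_link_deletion y (link x F)) -/P.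
rewrite (card_link_deletion y (deletion x F)) -/Q zero cards0.
case: r => [|r] in rD FD PD QD le1 *.
  have /set0Pn[A AP] := P0; have /set0Pn[B BQ] := Q0; have := PQ _ _ AP BQ.
  have /drawsP[_ /eqP] := subsetP PD _ AP.
  by rewrite cards_eq0 => /eqP ->; rewrite set0I eqxx.
(* Members containing both points are counted trivially; Pascal's rule combines this with the
   cross-intersecting bound. *)
have : #|link y (link x F)| <= 'C(#|D|.-2, r).
  by rewrite -Dxy -card_draws subset_leq_card // !link_draws.
have -> : #|D| - r.+3 = #|D|.-2 - r.+1 by lia.
have -> : #|D|.-1 = #|D|.-2.+1 by lia.
rewrite binS; move: le1.
move: #|link y (link x F)| #|P| #|Q| 'C(#|D|.-2 - r.+1, r.+1) 'C(#|D|.-2, r.+1) 'C(#|D|.-2, r).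
by move=> a b c d f g; lia.
Qed.

Theorem hilton_milner D r F : r.+1.*2 <= #|D| ->
  F \subset draws D r.+1 -> intersecting F -> starless F ->
  #|F| + 'C(#|D| - r.+2, r) <= 'C(#|D|.-1, r) + 1.
Proof.
move=> rD; have [w] := ubnP (weight F); elim: w => // w IH in F * => wF FD FI sl.
have [sF|A x y AF xD yD xy mA] := shiftedP D F.
  apply: hilton_milner_shifted => //.
  have [|v vD _] := @fresh_elt D set0; first by rewrite cards0; lia.
  by have [A AF _] := sl v; apply/set0Pn; exists A.
have lt := ltn_weight_shift xy AF mA.
have [/forallP slG|/forallPn[v /existsPn vG]] :=
   boolP [forall v, exists A, (A \in shift x y F) && (v \notin A)].
  rewrite -(card_shift x y F); apply: IH; rewrite ?shift_draws //; first by lia.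
    exact: cross_intersecting_shift.
  by move=> v; have /existsP[B /andP[]] := slG v; exists B.
have star B : B \in F -> v \in shift_set x y F B.
  by move=> BF; have := vG (shift_set x y F B); rewrite imset_f //= negbK.
(* Some member avoids [v] yet its image contains it, and [x] is the only element a shift inserts. *)
have vx : v = x.
  have [B BF vB] := sl v; have := star _ BF; rewrite /shift_set.
  case: ifP => _; last by rewrite (negbTE vB).
  by case/setU1P => // /setD1P[_]; rewrite (negbTE vB).
apply: (@hilton_milner_cover2 D r F x y) => //; first by apply: contraTneq xy => ->; rewrite ltnn.
move=> B /star; rewrite vx /shift_set; case: ifP => [/and3P[-> _ _]|_ ->] //.
by rewrite orbT.
Qed.

End SetFamilies.

(** * Independent sets in forests *)

Section Forests.
Variables (V : finType) (e : rel V).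
Hypotheses (esym : symmetric e) (eirr : irreflexive e) (eacyc : acyclic_graph e).
Implicit Types D A : {set V}.

(** If [z] lay on the path beyond the neighbour of [x], the edge from [x] to [z] would close a cycle
    of length at least 3. *)
Lemma acyclic_extend_path x p z : uniq (x :: p) -> path e x p -> e x z ->
  z != head x p -> z \notin x :: p.
Proof.
move=> up pp xz zh; rewrite inE negb_or; apply/andP; split.
  by apply: contraTneq xz => ->; rewrite eirr.
case: p => [//|y p] /= in up pp zh *; rewrite inE (negbTE zh) /=.
apply/negP => zp; case/splitPr: zp => p1 p2 in up pp *.
apply: (@eacyc [:: x, y & rcons p1 z]); first by rewrite /= size_rcons.
apply/andP; split.
  move: pp; rewrite /= cat_path /= => /and3P[-> pp1 /andP[lz _]].
  by rewrite rcons_path last_rcons rcons_path pp1 lz esym xz.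
have : uniq ([:: x, y & rcons p1 z] ++ p2) by rewrite /= cat_rcons.
by rewrite cat_uniq => /andP[].
Qed.

(** If every vertex of [D] had two neighbours in [D], simple paths inside [D] could be extended
    beyond [#|V|] vertices. *)
Lemma acyclic_leaf D : D != set0 -> exists2 w, w \in D & #|[set y in D | e w y]| <= 1.
Proof.
case/set0Pn=> x0 x0D; apply/exists_inP; apply: contraT => /exists_inPn big.
have long n : exists x p, [/\ size p = n, uniq (x :: p), path e x p & all [in D] (x :: p)].
  elim: n => [|n [x [p [sp up pp Dp]]]]; first by exists x0, [::]; rewrite /= x0D.
  have /andP[xD _] := Dp; have := big x xD; rewrite -ltnNge => N2.
  (* The new vertex must not step back to [head x p]. For empty [p] the default [x] is excluded,
     which costs nothing as [e] is irreflexive. *)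
  have : ~~ ([set y in D | e x y] \subset [set head x p]).
    by apply/negP => /subset_leq_card; rewrite cards1 leqNgt N2.
  case/subsetPn=> z; rewrite !inE => /andP[zD xz] zh.
  exists z, (x :: p); have zp := acyclic_extend_path up pp xz zh.
  by split; [rewrite /= sp | rewrite cons_uniq zp | rewrite /= esym xz | rewrite /= zD].
have [x [p [sp /card_uniqP up _ _]]] := long #|V|.
by have := max_card [in x :: p]; rewrite up /= sp ltnn.
Qed.

Definition indep_draws D k := [set A in draws D k | independent e A].

Lemma independentP A : reflect {in A &, forall x y, ~~ e x y} (independent e A).
Proof.
apply: (iffP forall_inP) => [h x y xA|h x xA]; first by have /forall_inP := h x xA; apply.
by apply/forall_inP => y; apply: h.
Qed.

Lemma independentU1 w A : independent e A -> {in A, forall y, ~~ e w y} -> independent e (w |: A).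
Proof.
move=> /independentP iA wA; apply/independentP => x y /setU1P[->|xA] /setU1P[->|yA].
- by rewrite eirr.
- exact: wA.
- by rewrite esym wA.
- exact: iA.
Qed.

(** Adjoining [w] is injective on the independent sets that avoid [w] and its neighbours, and
    preserves independence. *)
Lemma card_indep_draws_star D w k : w \in D ->
  #|indep_draws (D :\ w :\: [set y | e w y]) k| <= #|[set A in indep_draws D k.+1 | w \in A]|.
Proof.
move=> wD; set N := [set y | e w y].
have wA A : A \in indep_draws (D :\ w :\: N) k ->
    [/\ A \subset D :\ w :\: N, #|A| = k, w \notin A & independent e A].
  rewrite !inE => /andP[/andP[AD /eqP Ak] iA]; split=> //.
  by apply/negP => /(subsetP AD); rewrite !inE eqxx andbF.
rewrite -(card_in_imset (f := fun A => w |: A)); last first.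
  by move=> A B /wA[_ _ wA' _] /wA[_ _ wB' _] /(congr1 (fun C => C :\ w)); rewrite !setU1K.
apply: subset_leq_card; apply/subsetP=> _ /imsetP[A /wA[AD Ak wA' iA] ->].
rewrite !inE eqxx orTb andbT cardsU1 wA' Ak eqxx andbT subUset sub1set wD /=.
apply/andP; split.
  by apply: subset_trans AD _; apply/subsetP=> y; rewrite !inE => /and3P[].
by apply: independentU1 => // y /(subsetP AD); rewrite !inE => /andP[].
Qed.

Lemma leq_card_delete_leaf D w : w \in D -> #|[set y in D | e w y]| <= 1 ->
  #|D| <= #|D :\ w :\: [set y | e w y]|.+2.
Proof.
move=> wD wN; rewrite [X in X <= _](cardsD1 w) wD add1n ltnS [#|_ :\: [set y | _]|]cardsD.
suff : #|(D :\ w) :&: [set y | e w y]| <= 1 by lia.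
apply: leq_trans wN; apply: subset_leq_card.
by apply/subsetP=> y; rewrite !inE => /andP[/andP[_ ->]].
Qed.

(** The bound is the exact count for a path. Split at a vertex [w] of degree at most 1 in [D]: sets
    avoiding [w] live on one vertex fewer, sets containing it on at most two fewer, and Pascal's
    rule adds the counts. *)
Lemma card_indep_draws D k : 'C(#|D|.+1 - k, k) <= #|indep_draws D k|.
Proof.
have [n] := ubnP #|D|; elim: n => // n IH in D k * => Dn.
case: k => [|k].
  rewrite bin0 card_gt0; apply/set0Pn; exists set0; rewrite !inE sub0set cards0 eqxx /=.
  by apply/independentP => x y; rewrite inE.
have [->|D0] := eqVneq D set0; first by rewrite cards0 subSS sub0n bin0n.
have [w wD wN] := acyclic_leaf D0.
have Dw : #|D| = #|D :\ w|.+1 by rewrite (cardsD1 w) wD.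
have DN := leq_card_delete_leaf wD wN.
have le1 : 'C(#|D| - k.+1, k.+1) <= #|indep_draws (D :\ w) k.+1|.
  by rewrite Dw; apply: IH; lia.
have le2 : 'C(#|D| - k.+1, k) <= #|[set A in indep_draws D k.+1 | w \in A]|.
  apply: leq_trans (card_indep_draws_star _ wD).
  apply: (leq_trans _ (IH (D :\ w :\: [set y | e w y]) k _)); first by apply: leq_bin2l; lia.
  by apply: leq_ltn_trans (_ : #|D :\ w| < n); [apply/subset_leq_card/subsetDl | lia].
(* Pascal's rule, weakened to an inequality because the subtraction truncates when [#|D| <= k]. *)
have le3 : 'C(#|D|.+1 - k.+1, k.+1) <= 'C(#|D| - k.+1, k.+1) + 'C(#|D| - k.+1, k).
  by rewrite -binS; apply: leq_bin2l; lia.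
have dis : indep_draws (D :\ w) k.+1 :&: [set A in indep_draws D k.+1 | w \in A] = set0.
  apply/setP=> A; rewrite !inE subsetD1; apply/negbTE/negP.
  by case/and3P=> /andP[/andP[/andP[_ /negbTE wA] _] _] _; rewrite wA.
apply: (leq_trans le3); apply: (leq_trans (leq_add le1 le2)); rewrite -cardsUI dis cards0 addn0.
apply: subset_leq_card; rewrite subUset; apply/andP; split; apply/subsetP=> A; rewrite !inE.
  by rewrite subsetD1 => /andP[/andP[/andP[-> _] ->] ->].
by case/andP.
Qed.
Lemma card_leaf_star D w k : w \in D -> #|[set y in D | e w y]| <= 1 ->
  'C(#|D| - k.+1, k) <= #|[set A in indep_draws D k.+1 | w \in A]|.
Proof.
move=> wD /(leq_card_delete_leaf wD) DN.
apply: leq_trans (card_indep_draws_star _ wD).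
by apply: leq_trans (card_indep_draws _ _); apply: leq_bin2l; lia.
Qed.

End Forests.

(** * Falling factorials and the ratio of binomials *)

Local Open Scope ring_scope.

(** Each factor of [a ^_ k] is at least [d], so adding [r] to it multiplies it by at most
    [1 + r / d]. *)
Lemma ffact_ratio (R : realType) (a d k : nat) : (0 < d)%N -> (d + k <= a.+1)%N ->
   forall r : nat, ((a + r) ^_ k)%:R <= (1 + r%:R / d%:R) ^+ k * (a ^_ k)%:R :> R.
Proof.
move=> d0 + r; elim: k a => [|k IH] a dk; first by rewrite !ffactn0 expr0 mul1r.
case: a dk => [|a] dk; first by lia.
rewrite addSn !ffactSS exprS !natrM mulrACA ler_pM //; last by apply: IH; lia.
rewrite mulrDl mul1r -addSn natrD lerD2l.
rewrite mulrAC ler_pdivlMr ?ltr0n // -natrM.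
rewrite -natrM ler_nat leq_mul2l; apply/orP; right; lia.
Qed.

Lemma bin_ratio_le (R : realType) (n k : nat) (c : R) : 1 < c -> c <= 2 ->
  k.+1%:R <= Num.sqrt (n%:R * ln c) - ln c / 2 ->
  (k.+1.*2 <= n)%N /\ 'C(n.-1, k)%:R <= c * 'C(n - k.+2, k)%:R.
Proof.
move=> c1 c2; set r := k.+1; set L := ln c => hr.
have L0 : 0 < L by apply: ln_gt0.
have L1 : L <= 1.
  by have := @le_ln1Dx R (c - 1); rewrite (addrC 1) subrK -/L => /(_ _)/le_trans -> //; lra.
have r0 : 0 < r%:R :> R by rewrite ltr0n.
(* Square [r + L / 2 <= sqrt (n L)] and drop the term [L ^ 2 / 4]. *)
have sq : r%:R ^+ 2 + r%:R * L <= n%:R * L.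
  have nL0 : 0 <= n%:R * L by rewrite mulr_ge0 // ltW.
  have {}hr : r%:R + L / 2 <= Num.sqrt (n%:R * L) by lra.
  have : (r%:R + L / 2) ^+ 2 <= n%:R * L.
    by rewrite -(sqr_sqrtr nL0) ler_pXn2r // nnegrE ?sqrtr_ge0 //; lra.
  by have : 0 <= L ^+ 2 by [apply: sqr_ge0]; lra.
(* [r ^ 2 <= (n - r) L], and [L <= 1] with [r <= n] removes [L]. *)
have rn : r%:R ^+ 2 + r%:R <= n%:R :> R.
  have lt : r%:R <= n%:R :> R by rewrite -(ler_pM2r L0); nra.
  by nra.
have n2r : (r.*2 <= n)%N.
  move: rn; rewrite -natrX -natrD ler_nat /r; nia.
split=> //.
(* [d] is the smallest factor of [(n - k.+2) ^_ k]. *)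
pose d := (n.+1 - r.*2)%N.
have d0 : (0 < d)%N by rewrite /d; lia.
have dR : d%:R = n%:R + 1 - 2 * r%:R :> R.
  by rewrite natrB ?leqW // -natr1 -mul2n natrM.
have dR0 : 0 < d%:R :> R by rewrite ltr0n.
have := @ffact_ratio R (n - k.+2) d k d0 _ r.
have -> : (n - k.+2 + r = n.-1)%N by rewrite /r in n2r *; lia.
have pow : (1 + r%:R / d%:R) ^+ k <= c.
  apply: le_trans (_ : expR (r%:R / d%:R) ^+ k <= _).
    by rewrite lerXn2r ?nnegrE ?expR_ge0 ?expR_ge1Dx // addr_ge0 // divr_ge0.
  rewrite -expRM_natl -[leRHS]lnK ?posrE ?(lt_trans _ c1) // ler_expR -/L.
  rewrite mulrA ler_pdivrMr // dR.
  have -> : k%:R = r%:R - 1 :> R by rewrite /r -natr1 addrK.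
  (* By [sq], [L d >= r ^ 2 - r L + L], so [(r - 1) r <= L d] reduces to [(1 - L) r + L >= 0]. *)
  have : 0 <= (1 - L) * r%:R by rewrite mulr_ge0 ?subr_ge0 // ltW.
  nra.
move=> /(_ _)/le_trans H.
have {}H : (n.-1 ^_ k)%:R <= c * ((n - k.+2) ^_ k)%:R.
  by apply: H; [rewrite /d /r in n2r *; lia | rewrite ler_wpM2r].
have kf : 0 < (k`!)%:R :> R by rewrite ltr0n fact_gt0.
by rewrite -(ler_pM2r kf) -mulrA -!natrM !bin_ffact.
Qed.

(** * Stars and the EKR property of trees *)

Lemma sub_star (V : finType) (e : rel V) (r : nat) (F : {set {set V}}) (v : V) :
  F \subset indep_sets e r -> (forall A, A \in F -> v \in A) -> (#|F| <= star_size e r v)%N.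
Proof.
move=> /subsetP FI vF; apply: subset_leq_card; apply/subsetP=> A AF.
by rewrite inE FI ?vF.
Qed.

Lemma star_le_max (V : finType) (e : rel V) (r : nat) (F : {set {set V}}) (v : V) :
  max_intersecting e r F -> (star_size e r v <= #|F|)%N.
Proof.
case=> _ _; apply; first by apply/subsetP=> A; rewrite inE => /andP[].
move=> A B; rewrite !(in_set (fun _ => _ && _)) => /andP[_ vA] /andP[_ vB].
by apply/setI_neq0P; exists v.
Qed.

Theorem theorem2p5 (R : realType) (V : finType) (e : rel V) (n s r : nat) :
  tree e -> #|V| = n -> #|split_vertices e| = s -> (1 < s)%N -> (0 < r)%N ->
  let c : R := 2 - 2 * s%:R / r%:R in
  s%:R < r%:R / 2 :> R ->
  r%:R <= Num.sqrt (n%:R * ln c) - ln c / 2 ->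
  EKR e r.
Proof.
move=> [[esym eirr] [V0 _] eacyc] Vn _ s1 r0 c sr hr F maxF.
have rR : 0 < r%:R :> R by rewrite ltr0n.
have c1 : 1 < c.
  suff : 2 * s%:R / r%:R < 1 :> R by rewrite /c; lra.
  by rewrite ltr_pdivrMr // mul1r; lra.
have c2 : c <= 2.
  suff : 0 <= 2 * s%:R / r%:R :> R by rewrite /c; lra.
  by rewrite divr_ge0 // mulr_ge0.
(* From [2 s < r] and [1 < s]; it makes [k] positive, as the strict inequality [bin1] requires. *)
have r2 : (2 < r)%N.
  have : (s.*2 < r)%N by rewrite -(ltr_nat R) -mul2n natrM; lra.
  by lia.
case: r => [//|k] in r0 c sr hr maxF rR c1 c2 r2 *.
have [nk ratio] := bin_ratio_le c1 c2 hr.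
have [FD FI _] := maxF.
have [/forallP sl|/forallPn[v /existsPn vF]] :=
   boolP [forall v, exists A, (A \in F) && (v \notin A)]; last first.
  exists v; apply/eqP; rewrite eqn_leq star_le_max //= sub_star // => A AF.
  by have := vF A; rewrite AF /= negbK.
(* [F] is now starless, and the star of a leaf [w] of the whole tree is shown to be as large. *)
have [|w _ wN] := @acyclic_leaf V e esym eirr eacyc setT.
  by rewrite -card_gt0 cardsT.
exists w; apply/eqP; rewrite eqn_leq star_le_max //=.
have HM : (#|F| + 'C(n - k.+2, k) <= 'C(n.-1, k) + 1)%N.
  rewrite -Vn -cardsT; apply: hilton_milner => //.
  - by rewrite cardsT Vn.
  - by apply: subset_trans FD _; apply/subsetP=> A; rewrite !inE subsetT => /andP[].
  - by move=> v; have /existsP[A /andP[]] := sl v; exists A.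
have dbl : ('C(n.-1, k) <= 2 * 'C(n - k.+2, k))%N.
  by rewrite -(ler_nat R) natrM (le_trans ratio) // ler_wpM2r.
(* [HM] and [dbl] leave [#|F| <= 'C(n - k.+2, k) + 1]; strictness here pays for that 1. *)
have bin1 : ('C(n - k.+2, k) < 'C(n - k.+1, k))%N.
  rewrite (_ : n - k.+1 = (n - k.+2).+1)%N; last by lia.
  have k0 : (0 < k)%N by lia.
  by rewrite -(prednK k0) bin_succ_lt //; lia.
have := @card_leaf_star V e esym eirr eacyc setT w k (in_setT w) wN.
rewrite cardsT Vn (_ : [set A in _ | _] = [set A in indep_sets e k.+1 | w \in A]).
  rewrite -/(star_size e k.+1 w); move: 'C(n - k.+1, k) 'C(n - k.+2, k) 'C(n.-1, k) bin1 dbl HM => a b d.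
  by move: #|F| (star_size e k.+1 w) => f g; lia.
by apply/setP=> A; rewrite !inE subsetT /= [independent e A && _]andbC.
Qed.
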